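(* Let $m\ge2$ and $n\ge1$ be integers and let $\mathcal{A}$ be a real tensor of order $m$ and dimension $n$. Then $\mathcal{A}$ is centrosymmetric if and only if $J\mathcal{A}J=\mathcal{A}$; and $\mathcal{A}$ is skew centrosymmetric if and only if $J\mathcal{A}J=-\mathcal{A}$.
   Context: Write $[n]=\{1,\dots,n\}$. A real tensor of order $m$ and dimension $n$ is an array $\mathcal{A}=(a_{i_1\cdots i_m})$ of reals with $i_1,\dots,i_m\in[n]$. It is centrosymmetric if $a_{i_1\cdots i_m}=a_{n-i_1+1,\dots,n-i_m+1}$ for all indices, and skew centrosymmetric if $a_{i_1\cdots i_m}=-a_{n-i_1+1,\dots,n-i_m+1}$ for all indices. $J$ is the $n\times n$ real matrix with $J_{ij}=\delta_{i,\,n-j+1}$ (the exchange matrix; $\delta$ is the Kronecker delta). Tensor product: for $\mathcal{A}$ of order $m\ge2$ and $\mathcal{B}$ of order $k\ge1$, both of dimension $n$, $\mathcal{A}\mathcal{B}$ has order $(m-1)(k-1)+1$ and entries $(\mathcal{A}\mathcal{B})_{i\alpha_1\cdots\alpha_{m-1}}=\sum_{i_2,\dots,i_m\in[n]}a_{i i_2\cdots i_m}b_{i_2\alpha_1}\cdots b_{i_m\alpha_{m-1}}$ with $i\in[n]$, $\alpha_j\in[n]^{k-1}$. This product is associative. In particular, regarding $J$ as an order 2 tensor, $$(J\mathcal{A}J)_{i_1\cdots i_m}=\sum_{j_1,\dots,j_m\in[n]}J_{i_1j_1}a_{j_1j_2\cdots j_m}J_{j_2i_2}\cdots J_{j_mi_m}.$$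 *)

(* Defs.v *)
From mathcomp Require Import all_boot all_order all_algebra reals.

Set Implicit Arguments.
Unset Strict Implicit.
Unset Printing Implicit Defensive.

Import GRing.Theory.
Local Open Scope ring_scope.

(* Indices are 0-based: i : 'I_n stands for the index i + 1 of [n], so that
   n - i + 1 becomes rev_ord i. *)
Definition tensor (R : realType) (m n : nat) : Type :=
  {ffun m.-tuple 'I_n -> R}.

Definition centrosymmetric (R : realType) (m n : nat) (A : tensor R m n) : Prop :=
  forall t : m.-tuple 'I_n, A t = A (map_tuple (@rev_ord n) t).

Definition skew_centrosymmetric (R : realType) (m n : nat) (A : tensor R m n) :
    Prop :=
  forall t : m.-tuple 'I_n, A t = - A (map_tuple (@rev_ord n) t).

Definition exchange_mx (R : realType) (n : nat) : 'M[R]_n :=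
  \matrix_(i, j) (i == rev_ord j)%:R.

Definition tensor_of_mx (R : realType) (n : nat) (M : 'M[R]_n) : tensor R 2 n :=
  [ffun t : 2.-tuple 'I_n => M (tnth t ord0) (tnth t ord_max)].

Definition exchange (R : realType) (n : nat) : tensor R 2 n :=
  tensor_of_mx (exchange_mx R n).

Lemma block_index_subproof (m k : nat) (j : 'I_m) (l : 'I_k) : (j * k + l < m * k)%N.
Proof.
apply: (@leq_trans (j.+1 * k)); first by rewrite mulSn addnC ltn_add2r.
by rewrite leq_mul2r ltn_ord orbT.
Qed.

Definition block_index (m k : nat) (j : 'I_m) (l : 'I_k) : 'I_(m * k) :=
  Ordinal (block_index_subproof j l).

(* The j-th of the m consecutive blocks of length k of a tuple of length m * k. *)
Definition tuple_block (T : Type) (m k : nat) (t : (m * k).-tuple T) (j : 'I_m) :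
    k.-tuple T :=
  [tuple tnth t (block_index j l) | l < k].

(* The orders m.+1 and k.+1 of the factors are given by their predecessors, so
   the order (m.+1 - 1) * (k.+1 - 1) + 1 of the product is (m * k).+1.  An index
   tuple t of the product is i alpha_1 ... alpha_m with i = thead t. *)
Definition tensor_mul (R : realType) (m k n : nat)
    (A : tensor R m.+1 n) (B : tensor R k.+1 n) : tensor R (m * k).+1 n :=
  [ffun t : (m * k).+1.-tuple 'I_n =>
     \sum_(s : m.-tuple 'I_n)
        A (cons_tuple (thead t) s) *
        \prod_(j < m)
           B (cons_tuple (tnth s j) (tuple_block (behead_tuple t) j))].

(* Transport along an equality of orders, leaving the index sequences unchanged. *)
Definition tensor_cast (R : realType) (m m' n : nat) (e : m = m')
    (A : tensor R m n) : tensor R m' n :=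
  [ffun t : m'.-tuple 'I_n => A (tcast (esym e) t)].

Lemma order_conj (m : nat) : (1 * m * 1).+1 = m.+1.
Proof. by rewrite mul1n muln1. Qed.

(* The product (J A) J, whose order is only propositionally that of A. *)
Definition exchange_conj (R : realType) (m n : nat) (A : tensor R m.+1 n) :
    tensor R m.+1 n :=
  tensor_cast (order_conj m)
    (tensor_mul (tensor_mul (exchange R n) A) (exchange R n)).

(* Main.v *)
(* In (J A J)_t the factors of J vanish on every
   summation index except the reversal of t, where they are all 1, so
   (J A J)_t is the entry of A at the reversed index. *)
Require Import Defs.
From mathcomp Require Import all_boot all_order all_algebra reals.

Import GRing.Theory.
Local Open Scope ring_scope.

(** Multiplying by [J] on the left reverses the first index ([mul_exchange_tensor]), and on the
    right all the others ([mul_tensor_exchange]): each sum collapses to one term. Hence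
    [exchange_conjE], and both equivalences are this identity read entry by entry. *)

Lemma exchangeE (R : realType) (n : nat) (i : 'I_n) (s : 1.-tuple 'I_n) :
  exchange R n (cons_tuple i s) = (i == rev_ord (thead s))%:R.
Proof.
rewrite !ffunE mxE (tnth_nth i) /=; congr ((_ == rev_ord _)%:R).
by rewrite (tnth_nth i) /= /thead (tnth_nth i).
Qed.

Lemma tuple_block_head (T : Type) (p : nat) (t : (p * 1).-tuple T) (x0 : T)
    (j : 'I_p) :
  thead (tuple_block t j) = nth x0 t j.
Proof. by rewrite /thead tnth_mktuple (tnth_nth x0) /=; congr nth; rewrite muln1 addn0. Qed.

Lemma tuple_block_all (T : Type) (p : nat) (t : (1 * p).-tuple T) (j : 'I_1) :
  tuple_block t j = t :> seq T.
Proof.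
case: p t => [|p] t.
  (* For [p = 0], [T] may have no element to serve as default for [nth]; both sides are empty. *)
  by rewrite (size0nil (size_tuple t)) (tuple0 (tuple_block t j)).
have x0 : T by case: t => -[].
apply: (@eq_from_nth _ x0) => [|i]; rewrite size_tuple ?size_tuple ?mul1n // => lti.
rewrite -(tnth_nth x0 (tuple_block t j) (Ordinal lti)) tnth_mktuple (tnth_nth x0) /=.
by rewrite (ord1 j).
Qed.

(** The target index [w] is given by its underlying sequence, so that no cast between the orders
    [(1 * p).+1] and [p.+1] is needed. *)
Lemma mul_exchange_tensor (R : realType) (p n : nat) (A : tensor R p.+1 n)
    (t : (1 * p).+1.-tuple 'I_n) (w : p.+1.-tuple 'I_n) :
  w = rev_ord (thead t) :: behead t :> seq 'I_n ->
  tensor_mul (exchange R n) A t = A w.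
Proof.
move=> wE; rewrite ffunE (bigD1 [tuple rev_ord (thead t)]) //=.
rewrite [X in _ + X]big1 => [|s sN].
  rewrite addr0 exchangeE theadE rev_ordK (eqxx (thead t)) mul1r big_ord1.
  by congr (A _); apply: val_inj; rewrite /= tuple_block_all wE.
rewrite exchangeE; case: eqP => [tE|]; last by rewrite mul0r.
case/eqP: sN; rewrite tE rev_ordK; apply: eq_from_tnth => i.
by rewrite (ord1 i) (tnth_nth (thead t) [tuple _]).
Qed.

Lemma mul_tensor_exchange (R : realType) (p n : nat) (B : tensor R p.+1 n)
    (t : (p * 1).+1.-tuple 'I_n) (w : p.+1.-tuple 'I_n) :
  w = thead t :: map (@rev_ord n) (behead t) :> seq 'I_n ->
  tensor_mul B (exchange R n) t = B w.
Proof.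
move=> wE; rewrite ffunE (bigD1 (behead_tuple w)) //=.
rewrite [X in _ + X]big1 => [|s sN].
  rewrite addr0 big1 => [|j _].
    by rewrite mulr1; congr (B _); apply: val_inj; rewrite /= wE.
  rewrite exchangeE (tuple_block_head _ _ _ (thead t)).
  rewrite (tnth_nth (thead t)) /= wE /= (nth_map (thead t)) ?eqxx //.
  by rewrite size_behead size_tuple /= muln1.
(* A tuple other than the tail of [w] differs from it at some [j]; the [j]-th factor of the product
   is then zero. *)
have [j sj] : exists j, tnth s j != tnth (behead_tuple w) j.
  apply/existsP; rewrite -negb_forall; apply: contra sN => /forallP sE.
  by apply/eqP/eq_from_tnth => j; apply/eqP.
rewrite (bigD1 j) //= exchangeE (tuple_block_head _ _ _ (thead t)).
case: eqP => [sjE|]; last by rewrite mul0r mulr0.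
case/eqP: sj; rewrite sjE (tnth_nth (thead t)) /= wE /= (nth_map (thead t)) //.
by rewrite size_behead size_tuple /= muln1.
Qed.

Lemma exchange_conjE (R : realType) (m n : nat) (A : tensor R m.+1 n)
    (t : m.+1.-tuple 'I_n) :
  exchange_conj A t = A (map_tuple (@rev_ord n) t).
Proof.
rewrite ffunE; set u := tcast _ t.
have uE : u = t :> seq 'I_n by rewrite val_tcast.
(* [u] and [t] have different types, so their heads are compared through the underlying
   sequences. *)
have hE (p q : nat) (a : p.+1.-tuple 'I_n) (b : q.+1.-tuple 'I_n) :
    a = b :> seq 'I_n -> thead a = thead b.
  by move=> ab; rewrite /thead !(tnth_nth (thead a)) ab.
(* This is the index at which the entry of [J A] is taken: only its head remains to be reversed. *)
have vP : size (thead u :: map (@rev_ord n) (behead u)) == (1 * m).+1.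
  by rewrite /= size_map size_behead size_tuple /= muln1.
rewrite (@mul_tensor_exchange _ _ _ _ _ (Tuple vP)) //.
apply: mul_exchange_tensor => /=.
have -> : thead (Tuple vP) = thead u by rewrite /thead (tnth_nth (thead u)).
by rewrite (hE _ _ u t uE) uE {1}(tuple_eta t).
Qed.

Theorem theorem3p3 (R : realType) (m n : nat) (hn : (1 <= n)%N)
    (A : tensor R m.+2 n) :
  (centrosymmetric A <-> exchange_conj A = A) /\
  (skew_centrosymmetric A <-> exchange_conj A = - A).
Proof.
split; split=> [AE | JAJ t].
- by apply/ffunP => t; rewrite exchange_conjE -AE.
- by rewrite -exchange_conjE JAJ.
- by apply/ffunP => t; rewrite exchange_conjE ffunE (AE t) opprK.
- by rewrite -exchange_conjE JAJ ffunE opprK.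
Qed.
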